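(* For a Hausdorff space $X$, (a) $aL'(X)\leq z''(X)$, and (b) $|X|\leq 2^{z''(X)\,t_c(X)\,\psi_c(X)}$.
   Context: An open ultrafilter on a Hausdorff space $X$ is a maximal filter in the family of open subsets of $X$ (its members are nonempty open sets); it converges to $x\in X$ if it contains every open set containing $x$. $EX$ is the set of all convergent open ultrafilters on $X$. A section is a function $b:X\to EX$ such that $b(x)$ converges to $x$ for every $x\in X$. For a section $b$ and an open set $U$ let $\widehat{U}_b=\{x\in X: U\in b(x)\}$, and for $A\subseteq X$ let $c_b(A)=\{x\in X:\widehat{U}_b\cap A\neq\varnothing\text{ for every open }U\ni x\}$. $A$ is $c_b$-closed if $c_b(A)=A$. For $A\subseteq X$, $aL(A,X)$ is the least infinite cardinal $\kappa$ such that every cover $\mathcal V$ of $A$ by open sets of $X$ has a subfamily $\mathcal W$ with $|\mathcal W|\leq\kappa$ and $A\subseteq\bigcup_{W\in\mathcal W}cl\,W$. Put $aL^b(X)=\sup\{aL(C,X): C\text{ is }c_b\text{-closed}\}+\aleph_0$ and $aL'(X)=\min\{aL^b(X): b\text{ a section}\}$. Fix any section $b'$ with $aL^{b'}(X)=aL'(X)$ and write $\widehat{U}=\widehat{U}_{b'}$, $c=c_{b'}$. Let $\kappa$ be an infinite cardinal. For $A\subseteq X$ with $|A|\geq\kappa$ let $c^\kappa(A)=\{x\in X: |\widehat{U}\cap A|\geq\kappa\text{ for every open }U\ni x\}$. $X$ is $\kappa H''$-closed if for every $A\subseteq X$ with $|A|\geq\kappa$ and every family $\mathcal U$ of open sets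 of $X$ covering $c^\kappa(A)$ there is $\mathcal V\subseteq\mathcal U$ with $|\mathcal V|\leq\kappa$ and $|A\setminus\bigcup_{V\in\mathcal V}\widehat{V}|<\kappa$. (In particular, $X$ is $\kappa H''$-closed if $|X|<\kappa$.) Put $z''(X)=\inf\{\kappa\geq\aleph_0: X\text{ is }\kappa H''\text{-closed}\}$. $t_c(X)$ is the least infinite cardinal $\kappa$ such that whenever $x\in c(A)$, $A\subseteq X$, there is $B\subseteq A$ with $|B|\leq\kappa$ and $x\in c(B)$. $\psi_c(X)$ is the least infinite cardinal $\kappa$ such that each $x\in X$ has a family $\mathcal V$ of at most $\kappa$ open sets containing $x$ with $\{x\}=\bigcap_{V\in\mathcal V}cl\,V$. *)

(* Defs.v *)
From HB Require Import structures.
From mathcomp Require Import all_boot all_order.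
From mathcomp Require Import all_classical topology.

Set Implicit Arguments.
Unset Strict Implicit.
Unset Printing Implicit Defensive.

Local Open Scope classical_set_scope.
Local Open Scope card_scope.

(* A cardinal is represented by a type having that many elements, and two types
   represent the same cardinal when they are equipotent. *)

Definition card_lt (T U : Type) (A : set T) (B : set U) : Prop :=
  A #<= B /\ A #!= B.

Definition is_least_card (P : Type -> Prop) (K : Type) : Prop :=
  P K /\ forall L : Type, P L -> [set: K] #<= [set: L].

(* The default value is used only when no type satisfies [P]:
   see [least_cardP]. *)
Definition least_card (P : Type -> Prop) : Type :=
  if pselect (exists K, is_least_card P K) is left h
  then projT1 (cid h) else Empty_set.

Definition least_inf_card (P : Type -> Prop) : Type :=
  least_card (fun K => infinite_set [set: K] /\ P K).

Definition sup_card (P : Type -> Prop) : Type :=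
  least_card (fun K => forall L : Type, P L -> [set: L] #<= [set: K]).

Lemma injective_card_le (T U : Type) (f : T -> U) :
  injective f -> [set: T] #<= [set: U].
Proof.
move=> finj; have [//|] := (@injfunPex T U [set: T] [set: U]).2.
  by exists f => // x y _ _; exact: finj.
by move=> g; exact: inj_card_le g.
Qed.

Lemma card_le_injective (T U : Type) :
  [set: T] #<= [set: U] -> exists f : T -> U, injective f.
Proof.
move=> /card_leP/injfunPex[f _ finj].
exists (fun x => val (f (to_setT x))) => x y /val_inj e.
have := finj _ _ _ _ e; rewrite !inE => /(_ I I) /(congr1 val). exact.
Qed.

Lemma exists_least_family (I : Type) (F : I -> Type) (i0 : I) :
  exists i, forall j, [set: F i] #<= [set: F j].
Proof.
pose good (S : set (forall i, F i)) :=
  forall i s t, S s -> S t -> s i = t i -> s = t.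
have [|S [gS maxS]] := @Zorn_bigcup _ good.
  move=> C Cgood Ctot i s t [A CA As] [B CB Bt] st.
  case: (Ctot A B CA CB) => [AB|BA].
    exact: (Cgood _ CB i s t (AB _ As) Bt st).
  exact: (Cgood _ CA i s t As (BA _ Bt) st).
have [[i surj]|nsurj] := pselect (exists i, forall y : F i, exists2 s, S s & s i = y).
  have /choice[g gP] : forall y : F i, exists s, S s /\ s i = y.
    by move=> y; have [s Ss sy] := surj y; exists s.
  exists i => j; apply: (@injective_card_le _ _ (fun y => g y j)) => y z e.
  have [[Sy <-] [Sz <-]] := (gP y, gP z).
  by rewrite (gS j _ _ Sy Sz e).
have miss i : exists y : F i, forall s, S s -> s i <> y.
  apply: contrapT => /forallNP h; apply: nsurj; exists i => y.
  apply: contrapT => ny; apply: (h y) => s Ss sy; apply: ny; by exists s.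
pose p i : F i := projT1 (cid (miss i)).
have pP i s : S s -> s i <> p i by rewrite /p; case: cid => /= y; apply.
have Sp : ~ S p by move=> /(pP i0); apply.
exfalso; apply: (maxS (S `|` [set p])).
  by split; [exact: subsetUl|move=> h; apply: Sp; apply: h; right].
move=> i s t [Ss|->] [St|->] //.
- exact: gS.
- by move=> /pP.
- by move=> /esym /pP.
Qed.

Lemma card_le_totalT (T U : Type) :
  [set: T] #<= [set: U] \/ [set: U] #<= [set: T].
Proof.
have [[] h] := @exists_least_family bool (fun b => if b then T else U) true.
  by left; exact: (h false).
by right; exact: (h true).
Qed.

(* Cardinals are well ordered, so [least_card P] is a least element of every
   nonempty class [P]. *)
Lemma least_cardP (P : Type -> Prop) :
  (exists K, P K) -> is_least_card P (least_card P).
Proof.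
move=> [K0 PK0]; rewrite /least_card; case: pselect => [h|nh]; first by case: cid.
exfalso; apply: nh.
pose I := {S : set K0 | exists K, P K /\ S #= [set: K]}.
pose F (i : I) : Type := sval (cid (proj2_sig i)).
have FP (i : I) : P (F i) /\ sval i #= [set: F i] by rewrite /F; case: cid.
have i0 : I by exists setT, K0.
have [i imin] := exists_least_family F i0.
have key (S : set K0) L : P L -> S #= [set: L] -> [set: F i] #<= [set: L].
  move=> PL SL; have [j SFj] : exists j : I, S #= [set: F j].
    pose j : I := exist _ S (ex_intro _ L (conj PL SL)).
    by exists j; exact: (FP j).2.
  apply: (card_le_trans (imin j)).
  by move: SFj SL => /card_eqPle[_ FS] /card_eqPle[SL _]; exact: card_le_trans FS SL.
exists (F i); split; first by have [] := FP i.
move=> L PL; have [KL|/card_le_injective[f finj]] := card_le_totalT K0 L.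
  by apply: card_le_trans KL; exact: (key setT).
apply: (key (range f)) => //; apply: inj_card_eq => x y _ _; exact: finj.
Qed.

Section OpenUltrafilters.
Variable X : topologicalType.
Implicit Types (A C U V : set X) (F : set (set X)) (VV WW : set (set X)).

Definition open_filter F : Prop :=
  [/\ F setT,
      forall U, F U -> open U /\ U !=set0,
      forall U V, F U -> F V -> F (U `&` V) &
      forall U V, F U -> open V -> U `<=` V -> F V].

Definition open_ultrafilter F : Prop :=
  open_filter F /\ forall G, open_filter G -> F `<=` G -> G = F.

Definition open_converges F (x : X) : Prop :=
  forall U, open U -> U x -> F U.

Definition EX : Type :=
  {F : set (set X) | open_ultrafilter F /\ exists x, open_converges F x}.

Record EX_section := {
  section_fun :> X -> EX;
  section_converges : forall x, open_converges (sval (section_fun x)) x }.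

Definition hat (b : EX_section) U : set X := [set x | sval (b x) U].

Definition cb (b : EX_section) A : set X :=
  [set x | forall U, open U -> U x -> hat b U `&` A !=set0].

Definition cb_closed (b : EX_section) A : Prop := cb b A = A.

Definition open_cover VV A : Prop :=
  (forall V, VV V -> open V) /\ A `<=` \bigcup_(V in VV) V.

Definition aL A : Type := least_inf_card (fun K => forall VV, open_cover VV A ->
  exists WW, [/\ WW `<=` VV, WW #<= [set: K] &
    A `<=` \bigcup_(W in WW) closure W]).

Definition aLb (b : EX_section) : Type :=
  (sup_card (fun K => exists2 C, cb_closed b C & [set: K] #= [set: aL C])
   + nat)%type.

Definition aL' : Type :=
  least_card (fun K => exists b : EX_section, [set: K] #= [set: aLb b]).

(* [cb_ge b K A] is c^kappa(A) for kappa = |K|; it is only meaningful when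
   |A| >= kappa. *)
Definition cb_ge (b : EX_section) (K : Type) A : set X :=
  [set x | forall U, open U -> U x -> [set: K] #<= hat b U `&` A].

Definition H''_closed (b : EX_section) (K : Type) : Prop :=
  forall A, [set: K] #<= A ->
  forall VV, open_cover VV (cb_ge b K A) ->
  exists WW, [/\ WW `<=` VV, WW #<= [set: K] &
    card_lt (A `\` \bigcup_(W in WW) hat b W) [set: K]].

Definition z'' (b : EX_section) : Type := least_inf_card (H''_closed b).

Definition t_c (b : EX_section) : Type := least_inf_card (fun K =>
  forall (x : X) A, cb b A x ->
  exists B : set X, [/\ B `<=` A, B #<= [set: K] & cb b B x]).

End OpenUltrafilters.

Arguments aL' X : clear implicits.

Definition psi_c (X : topologicalType) : Type := least_inf_card (fun K =>
  forall x : X, exists VV : set (set X),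
  [/\ VV #<= [set: K], forall V, VV V -> open V /\ V x &
      [set x] = \bigcap_(V in VV) closure V]).

(* Main.v *)
(* For part (a), a c-closed set C contains c^kappa(C), so with kappa = z''(X) an
   open cover of C has a subfamily of size kappa whose closures cover C, up to
   fewer than kappa points, which are covered one by one.

   For part (b), let kappa be the product of the three cardinals and
   {x} = /\ cl V_i(x) over i in kappa.  A point x in c(B) is the only point of
   /\_i c(hat V_i(x) /\ B), so it is determined by B and kappa^2 bits.  Closing a
   point under the operations "take the point of /\_i c(B_i), where B_i is a
   subset of B" and "take a point outside a union of closures of sets V_i(x),
   x in B", for |B| <= kappa, gives a c-closed set H of size at most 2^kappa.  If
   p is not in H, the V_i(x) with x in H and p not in cl V_i(x) cover H, and
   the subfamily given by (a) yields a point of H outside its closures.  The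
   closure H is the image of a set of trees branching over kappa, which replaces
   the usual transfinite recursion of length kappa^+. *)
Require Import Defs.
From mathcomp Require Import all_boot all_order.
From mathcomp Require Import all_classical topology.

Set Implicit Arguments.
Unset Strict Implicit.
Unset Printing Implicit Defensive.

Local Open Scope classical_set_scope.
Local Open Scope card_scope.

(** * Squares of infinite cardinals *)

Lemma card_le_injfun (T U : Type) (u0 : U) (A : set T) (B : set U) :
  A #<= B -> exists2 f : T -> U, set_fun A B f & set_inj A f.
Proof.
elim/Ppointed: U => U in u0 B *; first by have := no u0.
by move=> /pcard_leP/injfunPex.
Qed.

Lemma card_le_range (T U : Type) (A : set T) :
  A !=set0 -> A #<= [set: U] -> exists g : U -> T, range g = A.
Proof.
by move=> /set0P/eqP A0 /pfcard_geP[//|/surjfunPex[g ->]]; exists g.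
Qed.

Lemma card_le_total (T U : Type) (A : set T) (B : set U) :
  A #<= B \/ B #<= A.
Proof.
have := card_le_totalT A B.
by rewrite !(card_le_eql (card_setT _)) !(card_le_eqr (card_setT _)).
Qed.

Section CardinalSquare.
Variables (K : Type) (e : nat -> K).
Hypothesis e_inj : injective e.

(** A pairing function on the subset [t.1]; [t.2] is made total, and only its values on [t.1] count.
    The points [e n] stay available as tags. *)
Let good (t : set K * (K -> K -> K)) : Prop :=
  [/\ forall n, t.1 (e n),
      forall x y, t.1 x -> t.1 y -> t.1 (t.2 x y) &
      forall x y x' y', t.1 x -> t.1 y -> t.1 x' -> t.1 y' ->
        t.2 x y = t.2 x' y' -> x = x' /\ y = y'].

Let below (s t : {t | good t}) : bool :=
  `[< (sval s).1 `<=` (sval t).1 /\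
      forall x y, (sval s).1 x -> (sval s).1 y ->
        (sval t).2 x y = (sval s).2 x y >].

Let exists_good : exists t, good t.
Proof.
have inv_e x : exists n, range e x -> e n = x.
  by case: (pselect (range e x)) => [[n _ <-]|?]; [exists n|exists 0].
have [i iP] := choice inv_e.
exists (range e, fun x y => e (pickle (i x, i y))); split => /=.
- by move=> n; exists n.
- by move=> x y _ _; exists (pickle (i x, i y)).
- move=> x y x' y' xe ye xe' ye' /e_inj/(pcan_inj pickleK)[ix iy].
  by rewrite -(iP x)// -(iP y)// ix iy !iP.
Qed.

Let chain_bound (C : set {t | good t}) :
  total_on C below -> exists t, forall s, C s -> below s t.
Proof.
move=> Ctot.
have [[s0 Cs0]|nC] := pselect (C !=set0); last first.
  have [t gt] := exists_good; exists (exist _ t gt) => s Cs.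
  by case: nC; exists s.
have common s t : C s -> C t -> exists r,
    [/\ C r, below s r & below t r].
  have refl r : below r r by apply/asboolP; split.
  by move=> Cs Ct; case: (Ctot s t Cs Ct) => h; [exists t|exists s].
(* The pairings of a chain agree where several are defined, so they glue to one function. *)
have /choice[f fP] : forall xy : K * K, exists z, forall s, C s ->
    (sval s).1 xy.1 -> (sval s).1 xy.2 -> (sval s).2 xy.1 xy.2 = z.
  move=> [x y] /=; have [[s [Cs [sx sy]]]|ns] := pselect (exists s, C s /\
    (sval s).1 x /\ (sval s).1 y); last first.
    by exists x => s Cs sx sy; case: ns; exists s.
  exists ((sval s).2 x y) => t Ct tx ty.
  have [r [_ /asboolP[_ sr] /asboolP[_ tr]]] := common _ _ Cs Ct.
  by rewrite -sr// -tr.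
pose D := \bigcup_(s in C) (sval s).1.
have Dcommon x y : D x -> D y -> exists s, [/\ C s, (sval s).1 x & (sval s).1 y].
  move=> [s Cs sx] [t Ct ty]; have [r [Cr /asboolP[sr _] /asboolP[tr _]]] :=
    common _ _ Cs Ct.
  by exists r; split=> //; [exact: sr|exact: tr].
have gD : good (D, fun x y => f (x, y)).
  split => /=.
  - by move=> n; exists s0 => //; case: (svalP s0).
  - move=> x y Dx Dy; have [s [Cs sx sy]] := Dcommon _ _ Dx Dy.
    rewrite -(fP (x, y) s)//; exists s => //.
    by case: (svalP s) => _ + _; apply.
  - move=> x y x' y' Dx Dy Dx' Dy'.
    have [s [Cs sx sy]] := Dcommon _ _ Dx Dy.
    have [t [Ct tx ty]] := Dcommon _ _ Dx' Dy'.
    have [r [Cr /asboolP[sr _] /asboolP[tr _]]] := common _ _ Cs Ct.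
    have [rx ry] := (sr _ sx, sr _ sy); have [rx' ry'] := (tr _ tx, tr _ ty).
    rewrite -(fP (x, y) r)// -(fP (x', y') r)//=.
    by case: (svalP r) => _ _; apply.
exists (exist _ _ gD) => s Cs; apply/asboolP; split => /=.
  by move=> x sx; exists s.
by move=> x y sx sy; have /= -> := fP (x, y) s Cs sx sy.
Qed.

(* A maximal [A] with an injection [A * A -> A] cannot be disjoint from a copy
   [B] of itself: the three new blocks [A * B], [B * A] and [B * B] would inject
   into [B], through [g (f (e i) (f x y))] with [i = 0, 1, 2]. *)
Lemma card_le_setX_of_seq : [set: K * K] #<= [set: K].
Proof.
have [t1 gt1] := exists_good.
have [|r s t /asboolP[rs rs'] /asboolP[st st']|C /chain_bound//|[[A f] gA] Amax]
    := @ZL_preorder _ (exist _ t1 gt1) below.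
- by move=> t; apply/asboolP; split.
- apply/asboolP; split; first exact: subset_trans st.
  by move=> x y rx ry; rewrite st' ?rs'//; exact: rs.
have /= [Ae Af Ainj] := gA.
(* The pairing on [A] transfers to [K] along any injection into [A]. *)
suff KA : exists g : K -> K, (forall x, A (g x)) /\ injective g.
  have [g [Ag ginj]] := KA.
  apply: (@injective_card_le _ _ (fun xy => f (g xy.1) (g xy.2))).
  by move=> [x y] [x' y'] /= /Ainj[]// /ginj -> /ginj ->.
(* If the complement is no larger than [A], the tags [e 0] and [e 1] fit both inside [A]; otherwise
   [g] places a copy of [A] outside it. *)
have [/(card_le_injfun (e 0))[g gnA ginj]|/(card_le_injfun (e 0))[g gB ginj]] :=
    card_le_total (~` A) A.
  exists (fun x => if pselect (A x) then f (e 0) x else f (e 1) (g x)); split.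
    by move=> x; case: pselect => h; apply: Af => //; exact: gnA.
  move=> x y; case: pselect => Ax; case: pselect => Ay.
  - by move=> /Ainj[].
  - by move=> /Ainj[]//; [exact: gnA|move=> /e_inj].
  - by move=> /Ainj[]//; [exact: gnA|move=> /e_inj].
  - by move=> /Ainj[]//; [exact: gnA|exact: gnA|]; move=> _ /ginj; rewrite !inE; apply.
exfalso.
have /choice[h gK] : forall b, exists a, (g @` A) b -> A a /\ g a = b.
  by move=> b; case: (pselect ((g @` A) b)) => [[a Aa <-]|?]; [exists a|exists b].
pose A' := A `|` g @` A.
(* [base x] is the point of [A] that [x] is or copies; [block] numbers the three new blocks. *)
pose base x := if pselect (A x) is left _ then x else h x.
pose block x y := if pselect (A x) is left _ then 0
  else if pselect (A y) is left _ then 1 else 2.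
pose f' x y := if pselect (A x /\ A y) is left _ then f x y
  else g (f (e (block x y)) (f (base x) (base y))).
have Abase x : A' x -> A (base x).
  by rewrite /base; case: pselect => // nAx [//|/gK[]].
have baseK x : A' x -> x = if pselect (A x) is left _ then base x else g (base x).
  by rewrite /base; case: pselect => // nAx [//|/gK[]].
have Aff x y : A' x -> A' y -> A (f (e (block x y)) (f (base x) (base y))).
  by move=> /Abase bx /Abase By; apply: (Af) => //; exact: Af.
have gA' : good (A', f').
  split => /=.
  - by move=> n; left; exact: Ae.
  - move=> x y A'x A'y; rewrite /f'; case: pselect => [[Ax Ay]|_].
      by left; exact: Af.
    by right; apply: imageP; exact: Aff.
  - move=> x y x' y' A'x A'y A'x' A'y'; rewrite /f'.
    case: pselect => [[Ax Ay]|nxy]; case: pselect => [[Ax' Ay']|nx'y'].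
    + exact: Ainj.
    + by move=> E; have := gB _ (Aff _ _ A'x' A'y'); rewrite -E; case; exact: Af.
    + by move=> E; have := gB _ (Aff _ _ A'x A'y); rewrite E; case; exact: Af.
    move=> /ginj; rewrite !inE => /(_ (Aff _ _ A'x A'y) (Aff _ _ A'x' A'y')).
    have [bx By] := (Abase _ A'x, Abase _ A'y).
    have [bx' By'] := (Abase _ A'x', Abase _ A'y').
    move=> /(Ainj _ _ _ _ (Ae _) (Af _ _ bx By) (Ae _) (Af _ _ bx' By')).
    move=> [/e_inj + /(Ainj _ _ _ _ bx By bx' By')[xx' yy']].
    (* Equal tags force the same coordinates to lie in [A]; equal bases then give equal points. *)
    move: nxy nx'y' (baseK _ A'x) (baseK _ A'y) (baseK _ A'x') (baseK _ A'y').
    rewrite -xx' -yy' /block.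
    by do 4![case: pselect => ?] => ? ? ? ? ? ? ?; solve [tauto | split; congruence].
have /asboolP[/= A'A _] : below (exist _ (A', f') gA') (exist _ (A, f) gA).
  apply: Amax; apply/asboolP; split => /=; first by move=> x; left.
  by move=> x y Ax Ay; rewrite /f'; case: pselect => // -[].
by apply: (gB _ (Ae 0)); apply: A'A; right; apply: imageP; exact: Ae.
Qed.

End CardinalSquare.

(** * Arithmetic of infinite cardinals *)

Lemma infinite_card_leP (K : Type) :
  infinite_set [set: K] <-> exists e : nat -> K, injective e.
Proof.
split=> [/infiniteP/card_le_injective//|[e /injective_card_le/infiniteP//]].
Qed.

Lemma card_le_square (K : Type) :
  infinite_set [set: K] -> [set: K * K] #<= [set: K].
Proof. by move=> /infinite_card_leP[e]; exact: card_le_setX_of_seq. Qed.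

Lemma card_le_sum (K A B : Type) : infinite_set [set: K] ->
  [set: A] #<= [set: K] -> [set: B] #<= [set: K] -> [set: A + B] #<= [set: K].
Proof.
move=> Kinf /card_le_injective[f finj] /card_le_injective[g ginj].
have [e einj] := (infinite_card_leP K).1 Kinf.
apply: (card_le_trans _ (card_le_square Kinf)).
apply: (@injective_card_le _ _
  (fun s => match s with inl a => (e 0, f a) | inr b => (e 1, g b) end)).
by move=> [a|b] [a'|b'] [] // => [/finj ->|/einj|/einj|/ginj ->].
Qed.

Lemma card_le_setU (K T : Type) (A B : set T) : infinite_set [set: K] ->
  A #<= [set: K] -> B #<= [set: K] -> A `|` B #<= [set: K].
Proof.
move=> Kinf AK BK; have := @card_le_sum K A B Kinf.
rewrite !(card_le_eql (card_setT _)) => /(_ AK BK); apply: card_le_trans.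
suff -> : A `|` B = range (fun s : A + B =>
    match s with inl a => val a | inr b => val b end).
  exact: card_image_le.
apply/seteqP; split => [x [Ax|Bx]|_ [[a|b] _ <-]].
- by exists (inl (SigSub (mem_set Ax))).
- by exists (inr (SigSub (mem_set Bx))).
- by left; apply: set_mem; exact: valP.
- by right; apply: set_mem; exact: valP.
Qed.

Lemma card_le_prod (K A B : Type) : infinite_set [set: K] ->
  [set: A] #<= [set: K] -> [set: B] #<= [set: K] -> [set: A * B] #<= [set: K].
Proof.
move=> Kinf /card_le_injective[f finj] /card_le_injective[g ginj].
apply: (card_le_trans _ (card_le_square Kinf)).
apply: (@injective_card_le _ _ (fun ab => (f ab.1, g ab.2))).
by move=> [a b] [a' b'] [/= /finj -> /ginj ->].
Qed.

Lemma card_le_option (K A : Type) : infinite_set [set: K] ->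
  [set: A] #<= [set: K] -> [set: option A] #<= [set: K].
Proof.
move=> Kinf AK; have [e einj] := (infinite_card_leP K).1 Kinf.
have: [set: A + unit] #<= [set: K].
  apply: card_le_sum => //; apply: (@injective_card_le _ _ (fun=> e 0)).
  by move=> [] [].
apply: card_le_trans; apply: (@injective_card_le _ _
  (fun o => if o is Some a then inl a else inr tt)).
by move=> [a|] [a'|] // [->].
Qed.

(** A fold of the pairing function can be decoded once the length is known, so the length is stored
    too. *)
Lemma card_le_seq (K : Type) :
  infinite_set [set: K] -> [set: seq K] #<= [set: K].
Proof.
move=> Kinf; have /card_le_injective[p pinj] := card_le_square Kinf.
have [e einj] := (infinite_card_leP K).1 Kinf.
apply: (card_le_trans _ (card_le_square Kinf)).
pose code := foldr (fun x c => p (x, c)) (e 0).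
apply: (@injective_card_le _ _ (fun s => (e (size s), code s))).
move=> s t [/einj + ]; elim: s t => [|x s IH] [|y t] //= [/IH{}IH].
by move=> /pinj[-> /IH ->].
Qed.

Lemma card_le_bool (A B : Type) :
  [set: A] #<= [set: B] -> [set: A -> bool] #<= [set: B -> bool].
Proof.
move=> /card_le_injective[f finj].
apply: (@injective_card_le _ _ (fun (p : A -> bool) b => `[< exists2 a, f a = b & p a >])).
move=> p q pq; apply/funext => a.
have E (r : A -> bool) : `[< exists2 a', f a' = f a & r a' >] = r a.
  by apply/asboolP/idP => [[a' /finj ->]|ra]; last exists a.
by rewrite -(E p) -(E q); have := congr1 (@^~ (f a)) pq.
Qed.

(** * Closing a point under an operation *)

(* A branch of a tree is a finite sequence of directions; recording at the end of
   each branch whether a node is there and which label it carries determines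
   the tree. *)
Inductive tree (L K : Type) : Type :=
| Leaf
| Node of L & (K -> tree L K).
Arguments Leaf {L K}.

(** [None] asks whether the branch ends at a node, [Some m] asks for bit [m] of its label. *)
Fixpoint tree_code (M K : Type) (t : tree (M -> bool) K)
    (bm : seq K * option M) : bool :=
  match t, bm.1, bm.2 with
  | Leaf, _, _ => false
  | Node l _, [::], o => if o is Some m then l m else true
  | Node _ f, k :: b, o => tree_code (f k) (b, o)
  end.

Lemma tree_code_inj (M K : Type) : injective (@tree_code M K).
Proof.
elim=> [|l f IH] [|l' f'] // E; first by have := congr1 (@^~ ([::], None)) E.
  by have := congr1 (@^~ ([::], None)) E.
congr Node; first by apply/funext => m; have := congr1 (@^~ ([::], Some m)) E.
apply/funext => k; apply: IH; apply/funext => -[b o].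
by have := congr1 (@^~ (k :: b, o)) E.
Qed.

(** Trees are terms: a leaf denotes [x0], a node labelled [l] applies [op l] to the values of its
    subtrees. The values of all terms form the closure. *)
Lemma closed_under_operation (M K X : Type) (op : (M -> bool) -> (K -> X) -> X)
    (x0 : X) :
  exists H : set X, [/\ H x0,
    forall l g, (forall k, H (g k)) -> H (op l g) &
    H #<= [set: seq K * option M -> bool]].
Proof.
pose eval := fix eval (t : tree (M -> bool) K) : X :=
  if t is Node l f then op l (fun k => eval (f k)) else x0.
exists (range eval); split.
- by exists Leaf.
- move=> l g Hg; have /choice[t tE] : forall k, exists t, eval t = g k.
    by move=> k; have [t _ <-] := Hg k; exists t.
  by exists (Node l t) => //=; congr op; exact/funext.
- apply: card_le_trans (card_image_le _ _) _.
  exact: injective_card_le (@tree_code_inj M K).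
Qed.

(** * Least cardinals and Cantor's theorem *)

Lemma least_inf_cardP (P : Type -> Prop) :
  (exists K, infinite_set [set: K] /\ P K) ->
  infinite_set [set: least_inf_card P] /\ P (least_inf_card P).
Proof. by move=> /least_cardP[]. Qed.

Lemma least_inf_card_le (P : Type -> Prop) (K : Type) :
  infinite_set [set: K] -> P K -> [set: least_inf_card P] #<= [set: K].
Proof.
move=> Kinf PK; apply: (least_cardP _).2; last by split.
by exists K.
Qed.

Lemma infinite_card_ge (K L : Type) :
  infinite_set [set: K] -> [set: K] #<= [set: L] -> infinite_set [set: L].
Proof. by move=> /infiniteP nK KL; apply/infiniteP; exact: card_le_trans KL. Qed.

Lemma infinite_sum_nat (A : Type) : infinite_set [set: A + nat].
Proof. by apply/infinite_card_leP; exists inr => x y []. Qed.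

Lemma card_le_inl (A B : Type) : [set: A] #<= [set: A + B].
Proof. by apply: (@injective_card_le _ _ inl) => x y []. Qed.

Lemma cantor_not_card_le (A : Type) : ~ ([set: A -> bool] #<= [set: A]).
Proof.
move=> /card_le_injective[f finj].
pose D a := `[< exists2 p, f p = a & ~~ p a >].
have DfD : D (f D) = ~~ D (f D).
  by apply/asboolP/idP => [[p /finj -> //]|nD]; exists D.
by case: (D (f D)) DfD.
Qed.

(** * The operator c and part (a) *)

Section OpenUltrafilterClosure.
Variables (X : topologicalType) (b : EX_section X).
Implicit Types (x y : X) (A B C U V : set X).

Lemma hat_nbhs U x : open U -> U x -> hat b U x.
Proof. exact: section_converges. Qed.

Lemma hatI U V x : hat b U x -> hat b V x -> hat b (U `&` V) x.
Proof. by rewrite /hat /=; case: (svalP (b x)) => -[[_ _ + _] _] _; apply. Qed.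

Lemma hat_nonempty U x : hat b U x -> U !=set0.
Proof. by rewrite /hat /=; case: (svalP (b x)) => -[[_ + _ _] _] _ => /[apply][[]]. Qed.

(** [U] and every open neighbourhood of [x] belong to the same filter [b x], so they meet. *)
Lemma hat_closure U x : hat b U x -> closure U x.
Proof.
move=> Ux B; rewrite nbhsE => -[V [oV Vx] VB].
have [y [Uy Vy]] := hat_nonempty (hatI Ux (hat_nbhs oV Vx)).
by exists y; split => //; exact: VB.
Qed.

Lemma subset_cb A : A `<=` cb b A.
Proof. by move=> x Ax U oU Ux; exists x; split => //; exact: hat_nbhs. Qed.

Lemma cb_nonempty A x : cb b A x -> A !=set0.
Proof. by move=> /(_ _ openT I)[y [_ Ay]]; exists y. Qed.

Lemma cb_ge_sub_cb (K : Type) A : [set: K] !=set0 -> cb_ge b K A `<=` cb b A.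
Proof.
move=> [k _] x h U oU Ux; apply/set0P/eqP => E; have := h U oU Ux.
by rewrite E card_le0 => /eqP K0; have : [set: K] k by []; rewrite K0.
Qed.

(** Testing [x] on the intersection of [U] and [V] finds a point of [B] whose filter contains
    both. *)
Lemma cb_hatI V B x : open V -> V x -> cb b B x -> cb b (hat b V `&` B) x.
Proof.
move=> oV Vx Bx U oU Ux; have [y [UVy By]] := Bx _ (openI oU oV) (conj Ux Vx).
move: UVy; rewrite /hat /=; case: (svalP (b y)) => -[[_ _ _ up] _] _ UVy.
by exists y; split; [|split] => //; apply: up UVy _ _ => // ? [].
Qed.

Lemma cb_hat_closure V B : cb b (hat b V `&` B) `<=` closure V.
Proof.
move=> x h A; rewrite nbhsE => -[U [oU Ux] UA].
have [y [Uy [Vy _]]] := h U oU Ux.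
have [z [Vz Uz]] := hat_nonempty (hatI Vy Uy).
by exists z; split => //; exact: UA.
Qed.

Lemma H''_closed_z'' : infinite_set [set: z'' b] /\ H''_closed b (z'' b).
Proof.
suff: exists K, infinite_set [set: K] /\ H''_closed b K.
  exact: least_inf_cardP.
(* Above |X| no set [A] is large enough, so the condition holds vacuously. *)
exists (X + nat -> bool); split.
  apply: infinite_card_ge (@infinite_sum_nat X) _.
  apply: (@injective_card_le _ _ (fun a c => `[< a = c >])) => x y xy.
  by have /asboolP := congr1 (@^~ y) xy; rewrite asboolT// => /(_ isT).
move=> A KA; exfalso; apply: (@cantor_not_card_le (X + nat)%type).
by apply: card_le_trans KA (card_le_trans (card_leT _) (card_le_inl _ _)).
Qed.

Lemma cb_closed_cover C VV : cb_closed b C -> open_cover VV C ->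
  exists WW, [/\ WW `<=` VV, WW #<= [set: z'' b] &
    C `<=` \bigcup_(W in WW) closure W].
Proof.
have [Kinf HK] := H''_closed_z''; set K := z'' b in Kinf HK *.
have K0 := infinite_setN0 Kinf.
move=> Cc [VVo VVC].
have [WW [WWV WWK CWK]] : exists WW, [/\ WW `<=` VV, WW #<= [set: K] &
    C `\` \bigcup_(W in WW) hat b W #<= [set: K]].
  (* If |C| is at most |K|, all of [C] may be left as remainder. *)
  have [CK|KC] := card_le_total C [set: K].
    exists set0; split; [exact: sub0set|exact: card_ge0|].
    exact: card_le_trans (card_le_setD _ _) CK.
  have [|WW [? ? []]] := HK C KC VV; last by exists WW.
  (* c^K(C) lies in c(C) = C, hence is covered by [VV]. *)
  by split => // x /(cb_ge_sub_cb K0); rewrite Cc; exact: VVC.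
(* Remaining points get one member of [VV] each; [set0] is a default outside [C]. *)
have /choice[V VP] : forall x, exists V, C x -> VV V /\ V x.
  move=> x; have [/VVC[V VVV Vx]|?] := pselect (C x); first by exists V.
  by exists set0.
exists (WW `|` V @` (C `\` \bigcup_(W in WW) hat b W)); split.
- by move=> W [/WWV//|[x [Cx _] <-]]; case: (VP x Cx).
- by apply: card_le_setU => //; exact: card_le_trans (card_image_le _ _) CWK.
- move=> x Cx; have [[W WWW Wx]|nWx] := pselect ((\bigcup_(W in WW) hat b W) x).
    by exists W; [left|exact: hat_closure].
  exists (V x); first by right; exists x.
  by apply: subset_closure; case: (VP x Cx).
Qed.

Lemma aL_le_z'' C : cb_closed b C -> [set: aL C] #<= [set: z'' b].
Proof.
move=> Cc; have [Kinf _] := H''_closed_z''.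
by apply: (least_inf_card_le Kinf) => VV; exact: cb_closed_cover.
Qed.

Lemma aLb_le_z'' : [set: aLb b] #<= [set: z'' b].
Proof.
have [Kinf _] := H''_closed_z''; apply: card_le_sum => //; last exact/infiniteP.
have bound L : (exists2 C, cb_closed b C & [set: L] #= [set: aL C]) ->
    [set: L] #<= [set: z'' b].
  by move=> [C /aL_le_z'' Cz /card_eqPle[LC _]]; exact: card_le_trans LC Cz.
by apply: (least_cardP _).2 => //; exists (z'' b).
Qed.

Lemma t_c_spec : infinite_set [set: t_c b] /\ forall x A, cb b A x ->
  exists B, [/\ B `<=` A, B #<= [set: t_c b] & cb b B x].
Proof.
suff: exists K, infinite_set [set: K] /\ forall x A, cb b A x ->
    exists B, [/\ B `<=` A, B #<= [set: K] & cb b B x].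
  exact: least_inf_cardP.
exists (X + nat)%type; split; first exact: infinite_sum_nat.
move=> x A Ax; exists A; split => //.
exact: card_le_trans (card_leT _) (card_le_inl _ _).
Qed.

End OpenUltrafilterClosure.

(** * Closed pseudocharacter and part (b) *)

(** In a Hausdorff space the closures of all open neighbourhoods of [x] meet only in [x], so
    [set X + nat] is large enough. *)
Lemma psi_c_spec (X : topologicalType) : hausdorff_space X ->
  infinite_set [set: psi_c X] /\ forall x : X, exists VV : set (set X),
    [/\ VV #<= [set: psi_c X], forall V, VV V -> open V /\ V x &
      [set x] = \bigcap_(V in VV) closure V].
Proof.
move=> hX; suff: exists K, infinite_set [set: K] /\
    forall x : X, exists VV : set (set X), [/\ VV #<= [set: K],
      forall V, VV V -> open V /\ V x & [set x] = \bigcap_(V in VV) closure V].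
  exact: least_inf_cardP.
exists (set X + nat)%type; split; first exact: infinite_sum_nat.
move=> x; exists [set V | open V /\ V x]; split => //.
  exact: card_le_trans (card_leT _) (card_le_inl _ _).
apply/seteqP; split => [_ -> V [_ Vx]|y h]; first exact: subset_closure.
apply/esym/hX => A B; rewrite nbhsE => -[V [oV Vx] VA] By.
have [z [Vz Bz]] := h V (conj oV Vx) _ By.
by exists z; split => //; exact: VA.
Qed.

Lemma closed_pseudocharacter_family (X : topologicalType) (K : Type) (x : X) :
  hausdorff_space X -> [set: psi_c X] #<= [set: K] ->
  exists V : K -> set X, (forall k, open (V k) /\ V k x) /\
    forall y, (forall k, closure (V k) y) -> y = x.
Proof.
move=> /psi_c_spec[_ /(_ x)[VV [VVK VVo VVx]]] cK.
(* An empty family means that [x] is the only point; the constant family [setT] then serves. *)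
have [VV0|VV0] := eqVneq VV set0.
  exists (fun=> setT); split=> [k|y _]; first by split => //; exact: openT.
  suff: [set x] y by []; by rewrite VVx VV0 bigcap_set0.
have [V VE] := card_le_range ((set0P _).1 VV0) (card_le_trans VVK cK).
exists V; split=> [k|y yV]; first by apply: VVo; rewrite -VE; exists k.
suff: [set x] y by [].
by rewrite VVx -VE => _ [k _ <-].
Qed.

Lemma card_le_pow_cb (X : topologicalType) (b : EX_section X) (K : Type) :
  hausdorff_space X -> infinite_set [set: K] -> [set: z'' b] #<= [set: K] ->
  [set: t_c b] #<= [set: K] -> [set: psi_c X] #<= [set: K] ->
  [set: X] #<= [set: K -> bool].
Proof.
move=> hX Kinf zK tK psiK.
have [[x0 _]|X0] := pselect ([set: X] !=set0); last first.
  by have -> : [set: X] = set0; [apply/seteqP; split => // x _; case: X0; exists x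
    |exact: card_ge0].
have /choice[V VP] := fun x => closed_pseudocharacter_family x hX psiK.
have Vo x k : open (V x k) by case: (VP x) => /(_ k)[].
have Vx x k : V x k x by case: (VP x) => /(_ k)[].
have V1 x y : (forall k, closure (V x k) y) -> y = x by case: (VP x) => _; apply.
(* The bits of [s] choose the sets B_i among the points of [g]. *)
pose limits (s : option (K * K) -> bool) (g : K -> X) : set X :=
  [set y | forall i, cb b (g @` [set k | s (Some (i, k))]) y].
pose uncovered (s : option (K * K) -> bool) (g : K -> X) : set X :=
  [set y | forall k i, s (Some (k, i)) -> ~ closure (V (g k) i) y].
(* The bit [None] selects the operation; [x0] is returned when the chosen set is empty. *)
pose op s g := xget x0 (if s None then limits s g else uncovered s g).
have [H [Hx0 Hop Hcard]] := closed_under_operation op x0.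
have cbH : cb_closed b H.
  apply/seteqP; split => [x Hx|]; last exact: subset_cb.
  have [B [BH BK Bx]] := (t_c_spec b).2 _ _ Hx.
  have [g gB] := card_le_range (cb_nonempty Bx) (card_le_trans BK tK).
  pose s o := if o is Some (i, k) then `[< hat b (V x i) (g k) >] else true.
  have limE i : g @` [set k | s (Some (i, k))] = hat b (V x i) `&` B.
    rewrite -gB; apply/seteqP; split=> [_ [k /asboolP ? <-]|y [yV [k _ gk]]].
      by split => //; exists k.
    by exists k => //; apply/asboolP; rewrite gk.
  suff -> : x = op s g by apply: Hop => k; apply: BH; rewrite -gB; exists k.
  (* [x] lies in each c(hat V_i /\ B), and a point of all of these lies in every cl V_i, so it is
     [x]. *)
  apply/esym/xget_unique => [i|y yl] /=; first by rewrite limE; exact: cb_hatI.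
  by apply: V1 => i; have := yl i; rewrite limE; exact: cb_hat_closure.
have HT : H = setT.
  apply/seteqP; split => // p _; apply: contrapT => nHp.
  pose VV := [set U | exists x i, [/\ H x, ~ closure U p & U = V x i]].
  have [|WW [WWV WWK HWW]] := @cb_closed_cover _ b H VV cbH.
    split=> [U [x [i [_ _ ->]]]|x Hx]; first exact: Vo.
    have [i nip] : exists i, ~ closure (V x i) p.
      by apply/existsNP => /V1 px; apply: nHp; rewrite px.
    by exists (V x i) => //; exists x, i.
  (* Enumerating [WW] by [K] requires it nonempty; it must cover [x0]. *)
  have WW0 : WW !=set0 by have [W ? _] := HWW _ Hx0; exists W.
  have [w wWW] := card_le_range WW0 (card_le_trans WWK zK).
  have /choice[xi xiP] : forall k, exists xi : X * K,
      [/\ H xi.1, ~ closure (w k) p & w k = V xi.1 xi.2].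
    move=> k; have [|x [i [? ? ?]]] := WWV (w k); first by rewrite -wWW; exists k.
    by exists (x, i).
  (* For each [k] only the index of [w k] is marked, and [None] selects [uncovered]. *)
  pose s o := if o is Some (k, i) then `[< i = (xi k).2 >] else false.
  pose g k := (xi k).1.
  have [W WWW] : (\bigcup_(W in WW) closure W) (op s g).
    by apply: HWW; apply: Hop => k; case: (xiP k).
  move: WWW; rewrite -wWW => -[k _ <-]; have [_ _ ->] := xiP k.
  (* [p] shows that this set is nonempty, so the value of [op] avoids every [closure (w k)], against
     the covering of [H]. *)
  have : uncovered s g (op s g).
    apply: xgetPex; exists p => {}k i /asboolP ->.
    by rewrite /g; have [_ + <-] := xiP k.
  by apply; exact/asboolP.
rewrite -HT; apply: card_le_trans Hcard _; apply: card_le_bool.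
apply: card_le_prod => //; first exact: card_le_seq.
by do 2!apply: card_le_option => //; exact: card_le_square.
Qed.

Theorem corollary5p20 (X : topologicalType) (b' : EX_section X) :
  hausdorff_space X ->
  [set: aLb b'] #= [set: aL' X] ->
  [set: aL' X] #<= [set: z'' b'] /\
  [set: X] #<= [set: (z'' b' * t_c b' * psi_c X)%type -> bool].
Proof.
move=> hX /card_eqPle[_ aL'b]; split; first exact: card_le_trans aL'b (aLb_le_z'' b').
have [zinf _] := H''_closed_z'' b'; have [tinf _] := t_c_spec b'.
have [pinf _] := psi_c_spec hX.
have [z _] := infinite_setN0 zinf; have [t _] := infinite_setN0 tinf.
have [p _] := infinite_setN0 pinf.
(* Each factor embeds in the product, the other coordinates being fixed. *)
have zK : [set: z'' b'] #<= [set: z'' b' * t_c b' * psi_c X].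
  by apply: (@injective_card_le _ _ (fun z : z'' b' => (z, t, p))) => ? ? [].
apply: (card_le_pow_cb hX _ zK); first exact: infinite_card_ge zK.
- by apply: (@injective_card_le _ _ (fun t : t_c b' => (z, t, p))) => ? ? [].
- by apply: (@injective_card_le _ _ (fun p : psi_c X => (z, t, p))) => ? ? [].
Qed.
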